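(* Let $\mathcal G(\Gamma)$ be a graph of groupoids based on a connected graph $\Gamma$ such that $\alpha_e(\mathcal G_e)$ is a wide subgroupoid of $\mathcal G_{t(e)}$ for every $e\in\Gamma^1$, let $T\subseteq\Gamma$ be a maximal subtree with a root, and fix an orientation $\Gamma^1_+$ of $\Gamma$. Let $X_{\mathcal G(\Gamma)}$ be the Bass-Serre forest of $\mathcal G(\Gamma)$. Then for every unit $x\in\pi_1(\mathcal G(\Gamma))^{(0)}$ the graph $xX_{\mathcal G(\Gamma)}$ is a tree.
   Context: **Groupoids and graphs.** A groupoid $\mathcal G$ is a small category with all morphisms invertible; $\mathcal G^{(0)}$ is its set of units (objects, identified with identities), $r,s$ are range and source, and $gh$ is defined iff $s(g)=r(h)$. A subgroupoid is wide if it contains all units. A graph $\Gamma$ (Serre) has a vertex set $\Gamma^0$, an edge set $\Gamma^1$, maps $o,t:\Gamma^1\to\Gamma^0$ and $e\mapsto\bar e$ on $\Gamma^1$ with $\bar e\ne e$, $\bar{\bar e}=e$, $t(\bar e)=o(e)$. A tree is a connected graph in which the only paths without backtracking ($e_1\cdots e_n$ with $o(e_i)=t(e_{i+1})$, $e_{i+1}\ne\bar e_i$) that start and end at the same vertex are those of length $0$. An orientation $\Gamma^1_+$ contains exactly one edge of each pair $\{e,\bar e\}$. A maximal subtree $T$ satisfies $T^0=\Gamma^0$. **Graph of groupoids.** $\mathcal G(\Gamma)$ consists of groupoids $\mathcal G_v$ ($v\in\Gamma^0$), $\mathcal G_e=\mathcal G_{\bar e}$ ($e\in\Gamma^1$)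 and injective groupoid homomorphisms $\alpha_e:\mathcal G_e\to\mathcal G_{t(e)}$ ($e\in\Gamma^1$). **Fundamental groupoid.** Put $\mathcal H_e=\alpha_e(\mathcal G_e)$ and $\phi_e=\alpha_e\circ\alpha_{\bar e}^{-1}:\mathcal H_{\bar e}\to\mathcal H_e$; by wideness $\phi_e$ restricts to a bijection $\mathcal G_{o(e)}^{(0)}\to\mathcal G_{t(e)}^{(0)}$. With $r$ the root of $T$, the bijections $\phi_e$, $e\in T^1$, generate an equivalence relation on $\bigsqcup_v\mathcal G_v^{(0)}$ for which $X=\mathcal G_r^{(0)}$ is a set of representatives; let $\tau:\bigsqcup_v\mathcal G_v^{(0)}\to X$ send each element to its representative. $\pi_1(\mathcal G(\Gamma))$ is the groupoid with unit space $X$ presented by: generators all $g\in\mathcal G_v$ ($v\in\Gamma^0$), with range $\tau(r(g))$ and source $\tau(s(g))$, and symbols $(\phi_e(x),x)$, one for each $e\in\Gamma^1$ and $x\in\mathcal G_{o(e)}^{(0)}$, with range $\tau(\phi_e(x))$ and source $\tau(x)$; relations: those of the vertex groupoids (a unit $y$ of $\mathcal G_v$ being identified with $\tau(y)$); $(\phi_e(x),x)^{-1}=(x,\phi_e(x))$, the latter being the symbol of $\bar e$ and $\phi_e(x)$; (R1) $(\phi_e(x),x)=\mathrm{id}_{\tau(x)}$ for $e\in T^1$; (R2) $(\alpha_e(r(g)),\alpha_{\bar e}(r(g)))\cdot\alpha_{\bar e}(g)\cdot(\alpha_{\bar e}(s(g)),\alpha_e(s(g)))=\alpha_e(g)$ for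 $g\in\mathcal G_e$, $e\in\Gamma^1$. **Bass-Serre forest.** Let $\varepsilon(e)=0$ if $e\in\Gamma^1_+$, $\varepsilon(e)=1$ otherwise, and let $|e|$ be the element of $\{e,\bar e\}\cap\Gamma^1_+$. For $p\in\pi_1(\mathcal G(\Gamma))$ and a vertex groupoid or subgroupoid $\mathcal K$ of one, $p\mathcal K=\{pk: k\in\mathcal K,\ s(p)=\tau(r(k))\}$. The graph $X_{\mathcal G(\Gamma)}$ has vertices the cosets $p\mathcal G_v$ tagged by $v$, written $p\mathcal G_v[v]$ ($v\in\Gamma^0$, $p\in\pi_1(\mathcal G(\Gamma))$), and edges the cosets $p\mathcal H_{|e|}$ tagged by $e$, written $p\mathcal H_{|e|}[e]$ ($e\in\Gamma^1$), with $o(p\mathcal H_{|e|}[e])=pe^{1-\varepsilon(e)}\mathcal G_{o(e)}[o(e)]$, $t(p\mathcal H_{|e|}[e])=pe^{-\varepsilon(e)}\mathcal G_{t(e)}[t(e)]$, $\overline{p\mathcal H_{|e|}[e]}=p\mathcal H_{|\bar e|}[\bar e]$. Here $pe^0=p$, $pe=p\cdot(\phi_e(y),y)$ with $y\in\mathcal G_{o(e)}^{(0)}$ the unit with $\tau(\phi_e(y))=s(p)$, and $pe^{-1}=p\bar e$. Let $\tilde\varphi:X_{\mathcal G(\Gamma)}^0\to\pi_1(\mathcal G(\Gamma))^{(0)}$, $\tilde\varphi(p\mathcal G_v[v])=r(p)$. For a unit $x$, $xX_{\mathcal G(\Gamma)}$ is the subgraph with vertex set $\tilde\varphi^{-1}(x)$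 and edge set $o^{-1}(\tilde\varphi^{-1}(x))$. *)

(* Defs.v *)
From mathcomp Require Import all_boot.
From mathcomp Require Import boolp classical_sets.
From Stdlib Require Import Relation_Operators.

Set Implicit Arguments.
Unset Strict Implicit.
Unset Printing Implicit Defensive.

Local Open Scope classical_set_scope.

Record graph := Graph {
  vert : Type;
  edge : Type;
  org : edge -> vert;
  tgt : edge -> vert;
  bar : edge -> edge;
  bar_neq : forall e, bar e <> e;
  barK : forall e, bar (bar e) = e;
  tgt_bar : forall e, tgt (bar e) = org e
}.

Lemma org_bar (G : graph) (e : edge G) : org (bar e) = tgt e.
Proof. by rewrite -tgt_bar barK. Qed.

(* Paths e_1 ... e_n are read right to left: org e_i = tgt e_(i+1).
   [gpath v s w]: s starts at w (= org e_n) and ends at v (= tgt e_1). *)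
Fixpoint gpath (G : graph) (v : vert G) (s : seq (edge G)) (w : vert G) : Prop :=
  if s is e :: s' then tgt e = v /\ gpath (org e) s' w else v = w.

Fixpoint no_backtracking (G : graph) (s : seq (edge G)) : Prop :=
  if s is e :: s' then
    (if s' is f :: _ then f <> bar e else True) /\ no_backtracking s'
  else True.

Definition connected (G : graph) : Prop :=
  inhabited (vert G) /\ forall v w : vert G, exists s, gpath v s w.

Definition tree (G : graph) : Prop :=
  connected G /\
  forall (v : vert G) (s : seq (edge G)),
    gpath v s v -> no_backtracking s -> s = [::].

Record subgraph (G : graph) := Subgraph {
  svert : set (vert G);
  sedge : set (edge G);
  sedge_org : forall e, sedge e -> svert (org e);
  sedge_tgt : forall e, sedge e -> svert (tgt e);
  sedge_bar : forall e, sedge e -> sedge (bar e)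
}.

Section SubgraphGraph.
Variables (G : graph) (S : subgraph G).

Definition sub_vert := {v : vert G | svert S v}.
Definition sub_edge := {e : edge G | sedge S e}.
Definition sub_org (e : sub_edge) : sub_vert :=
  exist _ (org (sval e)) (sedge_org (svalP e)).
Definition sub_tgt (e : sub_edge) : sub_vert :=
  exist _ (tgt (sval e)) (sedge_tgt (svalP e)).
Definition sub_bar (e : sub_edge) : sub_edge :=
  exist _ (bar (sval e)) (sedge_bar (svalP e)).

Lemma sub_bar_neq (e : sub_edge) : sub_bar e <> e.
Proof. by move=> /(congr1 sval) /=; apply: bar_neq. Qed.

Lemma sub_barK (e : sub_edge) : sub_bar (sub_bar e) = e.
Proof. by case: e => e He; apply: eq_exist; rewrite /= barK. Qed.

Lemma sub_tgt_bar (e : sub_edge) : sub_tgt (sub_bar e) = sub_org e.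
Proof. by apply: eq_exist; rewrite /= tgt_bar. Qed.

Definition graph_of_subgraph : graph :=
  Graph sub_bar_neq sub_barK sub_tgt_bar.

End SubgraphGraph.

Definition maximal_subtree (G : graph) (T : subgraph G) : Prop :=
  tree (graph_of_subgraph T) /\ svert T = setT.

Definition orientation (G : graph) (P : set (edge G)) : Prop :=
  forall e, (P e /\ ~ P (bar e)) \/ (~ P e /\ P (bar e)).

(* [gunit G] is the set of units, embedded in [arr G] by [idn]. The product
   [mul] is a total function, but [mul g h] is the composite gh, and is subject
   to any law, only when [src g = rng h]. *)
Record groupoid := Groupoid {
  gunit : Type;
  arr : Type;
  rng : arr -> gunit;
  src : arr -> gunit;
  idn : gunit -> arr;
  mul : arr -> arr -> arr;
  inv : arr -> arr;
  rng_idn : forall x, rng (idn x) = x;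
  src_idn : forall x, src (idn x) = x;
  rng_mul : forall g h, src g = rng h -> rng (mul g h) = rng g;
  src_mul : forall g h, src g = rng h -> src (mul g h) = src h;
  mul_assoc : forall g h k, src g = rng h -> src h = rng k ->
    mul g (mul h k) = mul (mul g h) k;
  idn_mul : forall g, mul (idn (rng g)) g = g;
  mul_idn : forall g, mul g (idn (src g)) = g;
  rng_inv : forall g, rng (inv g) = src g;
  src_inv : forall g, src (inv g) = rng g;
  inv_mul : forall g, mul (inv g) g = idn (src g);
  mul_inv : forall g, mul g (inv g) = idn (rng g)
}.

Record hom (A B : groupoid) := Hom {
  hunit : gunit A -> gunit B;
  harr :> arr A -> arr B;
  hom_rng : forall g, rng (harr g) = hunit (rng g);
  hom_src : forall g, src (harr g) = hunit (src g);
  hom_idn : forall x, harr (idn x) = idn (hunit x);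
  hom_mul : forall g h, src g = rng h ->
    harr (mul g h) = mul (harr g) (harr h)
}.

Definition hom_id (A : groupoid) : hom A A :=
  @Hom A A id id (fun=> erefl) (fun=> erefl) (fun=> erefl) (fun _ _ _ => erefl).

Definition hom_comp (A B C : groupoid) (f : hom B C) (g : hom A B) : hom A C.
Proof.
apply: (@Hom A C (hunit f \o hunit g) (f \o g)) => /=.
- by move=> a; rewrite !hom_rng.
- by move=> a; rewrite !hom_src.
- by move=> x; rewrite !hom_idn.
- by move=> a b ab; rewrite !hom_mul // hom_src hom_rng ab.
Defined.

Definition gcast (A B : groupoid) (E : A = B) : hom A B :=
  match E in _ = C return hom A C with erefl => hom_id A end.

Definition wide_subgroupoid (G : groupoid) (K : set (arr G)) : Prop :=
  [/\ forall g h, K g -> K h -> src g = rng h -> K (mul g h),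
      forall g, K g -> K (inv g)
    & forall x, K (idn x)].

Section Presentation.
(* X is the unit space, A the set of generators; [rel u v] imposes u = v. *)
Variables (X A : Type) (rg sr : A -> X).

(* (a, false) stands for a, and (a, true) for its formal inverse. *)
Definition letter : Type := A * bool.
Definition word : Type := seq letter.
Definition lrg (l : letter) : X := if l.2 then sr l.1 else rg l.1.
Definition lsr (l : letter) : X := if l.2 then rg l.1 else sr l.1.
Definition linv (l : letter) : letter := (l.1, ~~ l.2).
Definition winv (w : word) : word := rev (map linv w).

Fixpoint wpath (x : X) (w : word) (y : X) : Prop :=
  if w is l :: w' then lrg l = x /\ wpath (lsr l) w' y else x = y.

Variable rel : word -> word -> Prop.

Inductive wstep : word -> word -> Prop :=
| wstep_inv l : wstep [:: l; linv l] [::]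
| wstep_rel u v : rel u v -> wstep u v.

Inductive weq (x y : X) : word -> word -> Prop :=
| weq_refl w : wpath x w y -> weq x y w w
| weq_sym u v : weq x y u v -> weq x y v u
| weq_trans u v w : weq x y u v -> weq x y v w -> weq x y u w
| weq_step w1 u v w2 : wstep u v ->
    wpath x (w1 ++ u ++ w2) y -> wpath x (w1 ++ v ++ w2) y ->
    weq x y (w1 ++ u ++ w2) (w1 ++ v ++ w2).

Record parr := PArr {
  prng : X;
  psrc : X;
  pcls : set word;
  pclsP : exists2 w, wpath prng w psrc & pcls = weq prng psrc w
}.

Definition pclass x w y (H : wpath x w y) : parr :=
  @PArr x y (weq x y w) (ex_intro2 _ _ w H erefl).

Lemma wpath_cat x u v y :
  wpath x (u ++ v) y <-> exists z, wpath x u z /\ wpath z v y.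
Proof.
elim: u x => [|l u IH] x /=.
  by split=> [H|[z [<- //]]]; exists x.
split=> [[<- /IH [z [Hu Hv]]]|[z [[<- Hu] Hv]]]; first by exists z.
by split=> //; apply/IH; exists z.
Qed.

Lemma wpath_catI x u z v y : wpath x u z -> wpath z v y -> wpath x (u ++ v) y.
Proof. by move=> Hu Hv; apply/wpath_cat; exists z. Qed.

Lemma lrg_inv l : lrg (linv l) = lsr l. Proof. by case: l => a []. Qed.
Lemma lsr_inv l : lsr (linv l) = lrg l. Proof. by case: l => a []. Qed.

Lemma winv_cons l w : winv (l :: w) = winv w ++ [:: linv l].
Proof. by rewrite /winv /= rev_cons -cats1. Qed.

Lemma wpath_winv x w y : wpath x w y -> wpath y (winv w) x.
Proof.
elim: w x => [|l w IH] x /=; first by move=> ->.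
case=> <- /IH H; rewrite winv_cons; apply: wpath_catI H _.
by rewrite /= lrg_inv lsr_inv.
Qed.

Lemma weq_wpath x y u v : weq x y u v -> wpath x u y /\ wpath x v y.
Proof. by elim=> // {}u {}v; tauto. Qed.

Lemma weq_cat2 x y z w u v w' t :
  wpath x w y -> weq y z u v -> wpath z w' t ->
  weq x t (w ++ u ++ w') (w ++ v ++ w').
Proof.
move=> Hw; elim=> {u v} [u Hu|u v _ IH|u v s _ IH1 _ IH2|w1 u v w2 S H1 H2] Hw'.
- by apply: weq_refl; apply: wpath_catI Hw _; apply: wpath_catI Hu _.
- exact: weq_sym (IH Hw').
- exact: weq_trans (IH1 Hw') (IH2 Hw').
- have E s : w ++ (w1 ++ s ++ w2) ++ w' = (w ++ w1) ++ s ++ (w2 ++ w').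
    by rewrite !catA.
  rewrite !E; apply: weq_step S _ _; rewrite -E.
    by apply: wpath_catI Hw _; apply: wpath_catI H1 _.
  by apply: wpath_catI Hw _; apply: wpath_catI H2 _.
Qed.

Lemma weq_cat x y z u u' v v' :
  weq x y u u' -> weq y z v v' -> weq x z (u ++ v) (u' ++ v').
Proof.
move=> Hu Hv; have [pu pu'] := weq_wpath Hu; have [pv pv'] := weq_wpath Hv.
apply: (weq_trans (v := u' ++ v)).
  exact: (@weq_cat2 x x y [::] u u' v z).
by rewrite -[v]cats0 -[v']cats0; apply: weq_cat2 pu' Hv _.
Qed.

Lemma weq_invr x w y : wpath x w y -> weq x x (w ++ winv w) [::].
Proof.
elim: w x => [|l w IH] x /=; first by move=> _; apply: weq_refl.
case=> <- H; rewrite winv_cons.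
apply: (weq_trans (v := [:: l] ++ [::] ++ [:: linv l])).
  have -> : l :: w ++ winv w ++ [:: linv l]
          = [:: l] ++ (w ++ winv w) ++ [:: linv l] by rewrite /= catA.
  apply: weq_cat2 (IH _ H) _ => //=.
  by rewrite lrg_inv lsr_inv.
apply: (@weq_step _ _ [::] [:: l; linv l] [::] [::]) => //=.
  exact: wstep_inv.
by rewrite lrg_inv lsr_inv.
Qed.

Lemma winvK w : winv (winv w) = w.
Proof.
rewrite /winv map_rev revK -map_comp -[RHS]map_id.
by apply: eq_map => -[a []].
Qed.

Lemma weq_invl x w y : wpath x w y -> weq y y (winv w ++ w) [::].
Proof. by move/wpath_winv/weq_invr; rewrite winvK. Qed.

Lemma weq_winv x y u v : weq x y u v -> weq y x (winv u) (winv v).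
Proof.
move=> H; have [pu pv] := weq_wpath H.
have iu := wpath_winv pu; have iv := wpath_winv pv.
apply: (weq_trans (v := (winv v ++ v) ++ winv u)).
  by apply: weq_sym; apply: (weq_cat (u' := [::]) (v' := winv u));
    [exact: weq_invl pv|exact: weq_refl].
rewrite -catA -[X in weq _ _ _ X]cats0.
apply: weq_cat (weq_refl iv) _.
apply: weq_trans (weq_invr pu).
by apply: weq_cat (weq_sym H) (weq_refl iu).
Qed.

Lemma weq_cls x y u v : weq x y u v -> weq x y u = weq x y v.
Proof.
move=> H; apply/funext => w; apply/propext; split=> K.
  exact: weq_trans (weq_sym H) K.
exact: weq_trans H K.
Qed.

Lemma parr_eq (a b : parr) :
  prng a = prng b -> psrc a = psrc b -> pcls a = pcls b -> a = b.
Proof.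
case: a b => x y C p [x' y' C' p'] /= Ex Ey EC; subst.
by congr PArr; apply: Prop_irrelevance.
Qed.

Lemma pclass_eq x w y (H : wpath x w y) w' (H' : wpath x w' y) :
  weq x y w w' -> pclass H = pclass H'.
Proof. by move=> /weq_cls E; apply: parr_eq. Qed.

Lemma parrP (a : parr) : exists x w y (H : wpath x w y), a = pclass H.
Proof.
case: a => x y C [w H E]; exists x, w, y, H; exact: parr_eq.
Qed.

Lemma pmul_subproof (a b : parr) : psrc a = prng b ->
  exists2 w, wpath (prng a) w (psrc b)
  & [set w | exists u v, [/\ pcls a u, pcls b v
                           & weq (prng a) (psrc b) (u ++ v) w]]
    = weq (prng a) (psrc b) w.
Proof.
case: a b => x y C [u pu EC] [y' z D [v pv ED]] /= E; subst y' C D.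
exists (u ++ v); first exact: wpath_catI pu pv.
apply/funext => w; apply/propext; split=> [[u' [v' [H1 H2 H3]]]|H].
  exact: weq_trans (weq_cat H1 H2) H3.
by exists u, v; split=> //; apply: weq_refl.
Qed.

Definition pmul (a b : parr) : parr :=
  match pselect (psrc a = prng b) with
  | left E => PArr (pmul_subproof E)
  | right _ => a
  end.

Lemma pinv_subproof (a : parr) :
  exists2 w, wpath (psrc a) w (prng a)
  & [set w | exists2 u, pcls a u & weq (psrc a) (prng a) (winv u) w]
    = weq (psrc a) (prng a) w.
Proof.
case: a => x y C [u pu EC] /=; subst C.
exists (winv u); first exact: wpath_winv.
apply/funext => w; apply/propext; split=> [[u' H1 H2]|H].
  exact: weq_trans (weq_winv H1) H2.
by exists u => //; apply: weq_refl.
Qed.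

Definition pinv (a : parr) : parr := PArr (pinv_subproof a).

Definition pidn (x : X) : parr := @pclass x [::] x erefl.

Lemma pmulE x u y (Hu : wpath x u y) z v (Hv : wpath y v z) :
  pmul (pclass Hu) (pclass Hv) = pclass (wpath_catI Hu Hv).
Proof.
rewrite /pmul; case: pselect => //= E; apply: parr_eq => //=.
apply/funext => w; apply/propext; split=> [[u' [v' [H1 H2 H3]]]|H].
  exact: weq_trans (weq_cat H1 H2) H3.
by exists u, v; split=> //; apply: weq_refl.
Qed.

Lemma pinvE x u y (Hu : wpath x u y) :
  pinv (pclass Hu) = pclass (wpath_winv Hu).
Proof.
apply: parr_eq => //=.
apply/funext => w; apply/propext; split=> [[u' H1 H2]|H].
  exact: weq_trans (weq_winv H1) H2.
by exists u => //; apply: weq_refl.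
Qed.

Lemma prng_mul a b : psrc a = prng b -> prng (pmul a b) = prng a.
Proof. by rewrite /pmul; case: pselect. Qed.

Lemma psrc_mul a b : psrc a = prng b -> psrc (pmul a b) = psrc b.
Proof. by rewrite /pmul; case: pselect. Qed.

Lemma pmulA a b c : psrc a = prng b -> psrc b = prng c ->
  pmul a (pmul b c) = pmul (pmul a b) c.
Proof.
have [x [u [y [pu ->]]]] := parrP a; have [y' [v [z [pv ->]]]] := parrP b.
have [z' [w [t [pw ->]]]] := parrP c => /= E1 E2; subst y' z'.
rewrite !pmulE; apply: pclass_eq; rewrite catA.
by apply: weq_refl; apply: wpath_catI (wpath_catI pu pv) pw.
Qed.

Lemma pidn_mul a : pmul (pidn (prng a)) a = a.
Proof.
have [x [u [y [pu ->]]]] := parrP a.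
by rewrite /= pmulE; apply: pclass_eq; apply: weq_refl.
Qed.

Lemma pmul_idn a : pmul a (pidn (psrc a)) = a.
Proof.
have [x [u [y [pu ->]]]] := parrP a.
by rewrite /= pmulE; apply: pclass_eq; rewrite cats0; apply: weq_refl.
Qed.

Lemma pinv_mul a : pmul (pinv a) a = pidn (psrc a).
Proof.
have [x [u [y [pu ->]]]] := parrP a.
by rewrite pinvE pmulE; apply: pclass_eq; apply: weq_invl pu.
Qed.

Lemma pmul_inv a : pmul a (pinv a) = pidn (prng a).
Proof.
have [x [u [y [pu ->]]]] := parrP a.
by rewrite pinvE pmulE; apply: pclass_eq; apply: weq_invr pu.
Qed.

Definition presented_groupoid : groupoid :=
  @Groupoid X parr prng psrc pidn pmul pinv
    (fun=> erefl) (fun=> erefl) prng_mul psrc_mul pmulA pidn_mul pmul_idn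
    (fun=> erefl) (fun=> erefl) pinv_mul pmul_inv.

Lemma pgen_wpath (a : A) : wpath (rg a) [:: (a, false)] (sr a).
Proof. by []. Qed.

Definition pgen (a : A) : arr presented_groupoid := pclass (pgen_wpath a).

Lemma pcls_gen a : pcls (pgen a) [:: (a, false)].
Proof. by apply: weq_refl. Qed.

Lemma pcls_mul a b u v : psrc a = prng b -> pcls a u -> pcls b v ->
  pcls (pmul a b) (u ++ v).
Proof.
have [x [u' [y [pu ->]]]] := parrP a; have [y' [v' [z [pv ->]]]] := parrP b.
by move=> /= E; subst y' => H1 H2; rewrite pmulE /=; exact: weq_cat H1 H2.
Qed.

Lemma pcls_rel a b u v : prng a = prng b -> psrc a = psrc b ->
  pcls a u -> pcls b v -> rel u v -> a = b.
Proof.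
have [x [u' [y [pu ->]]]] := parrP a; have [x' [v' [y' [pv ->]]]] := parrP b.
move=> /= E E' H1 H2 R; subst x' y'; apply: pclass_eq.
have [_ H1'] := weq_wpath H1; have [_ H2'] := weq_wpath H2.
apply: weq_trans H1 _; apply: weq_trans (weq_sym H2).
have := @weq_step x y [::] u v [::] (wstep_rel R).
by rewrite /= !cats0; apply.
Qed.

Lemma pcls_inv a u : pcls a u -> pcls (pinv a) (winv u).
Proof.
have [x [u' [y [pu ->]]]] := parrP a; rewrite pinvE; exact: weq_winv.
Qed.

End Presentation.

Record graph_of_groupoids (G : graph) := GraphOfGroupoids {
  Gv : vert G -> groupoid;
  Ge : edge G -> groupoid;
  Ge_bar : forall e, Ge (bar e) = Ge e;
  alpha : forall e, hom (Ge e) (Gv (tgt e));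
  alpha_inj : forall e, injective (alpha e)
}.

Section GraphOfGroupoids.
Variables (G : graph) (D : graph_of_groupoids G).

Definition Hsub (e : edge G) : set (arr (Gv D (tgt e))) := range (alpha D e).

(* alpha_(bar e), seen as a homomorphism G_e -> G_(o(e)) through the equalities
   G_(bar e) = G_e and t(bar e) = o(e). *)
Definition alpha_org (e : edge G) : hom (Ge D e) (Gv D (org e)) :=
  hom_comp (gcast (congr1 (Gv D) (tgt_bar e)))
    (hom_comp (alpha D (bar e)) (gcast (esym (Ge_bar D e)))).

(* The identification of G_(t(e)) with G_(o(bar e)). *)
Definition flip (e : edge G) : hom (Gv D (tgt e)) (Gv D (org (bar e))) :=
  gcast (congr1 (Gv D) (esym (org_bar e))).

End GraphOfGroupoids.

Arguments Hsub {G} D e _.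

Section FundamentalGroupoid.
Variables (G : graph) (D : graph_of_groupoids G).
Hypothesis wideD : forall e, wide_subgroupoid (Hsub D e).
Variable T : subgraph G.
Hypothesis maxT : maximal_subtree T.
Variable root : vert G.

Local Notation unitv v := (gunit (Gv D v)).

Lemma alpha_wide e (x : unitv (tgt e)) : exists u, hunit (alpha D e) u = x.
Proof.
have [_ _ /(_ x) [g _ Eg]] := wideD e.
by exists (rng g); rewrite -hom_rng Eg rng_idn.
Qed.

Lemma gcast_surj (A B : groupoid) (E : A = B) y : exists x, hunit (gcast E) x = y.
Proof. by case: B / E y => y; exists y. Qed.

Lemma alpha_org_wide e (x : unitv (org e)) :
  exists u, hunit (alpha_org D e) u = x.
Proof.
have [y <-] := gcast_surj (congr1 (Gv D) (tgt_bar e)) x.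
have [u <-] := alpha_wide y.
by have [w <-] := gcast_surj (esym (Ge_bar D e)) u; exists w.
Qed.

(* phi_e = alpha_e o alpha_(bar e)^-1, restricted to units *)
Definition phi (e : edge G) (x : unitv (org e)) : unitv (tgt e) :=
  hunit (alpha D e) (projT1 (cid (alpha_org_wide x))).

Lemma hunit_inj (A B : groupoid) (f : hom A B) :
  injective f -> injective (hunit f).
Proof.
move=> fI x y E; have : f (idn x) = f (idn y) by rewrite !hom_idn E.
by move/fI/(congr1 (@rng _)); rewrite !rng_idn.
Qed.

Lemma gcast_inj (A B : groupoid) (E : A = B) : injective (gcast E).
Proof. by case: B / E. Qed.

Lemma alpha_org_inj e : injective (alpha_org D e).
Proof. by move=> x y /gcast_inj /alpha_inj /gcast_inj. Qed.

Lemma phiE e u : phi (hunit (alpha_org D e) u) = hunit (alpha D e) u.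
Proof.
rewrite /phi; case: cid => w /= E; congr hunit.
exact: hunit_inj (@alpha_org_inj e) _ _ E.
Qed.

Lemma phi_inj e : injective (@phi e).
Proof.
move=> x y; have [u <-] := alpha_org_wide x; have [w <-] := alpha_org_wide y.
by rewrite !phiE => /(hunit_inj (@alpha_inj _ D e)) ->.
Qed.

Lemma phi_surj e (y : unitv (tgt e)) : exists x, phi x = y.
Proof.
by have [u <-] := alpha_wide y; exists (hunit (alpha_org D e) u); rewrite phiE.
Qed.

Lemma alpha_cast e' e (E : e' = e) B (HA : Ge D e = Ge D e')
    (HB : Gv D (tgt e') = B) (HC : Gv D (tgt e) = B) :
  (forall g, gcast HB (alpha D e' (gcast HA g)) = gcast HC (alpha D e g)) /\
  (forall u, hunit (gcast HB) (hunit (alpha D e') (hunit (gcast HA) u))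
     = hunit (gcast HC) (hunit (alpha D e) u)).
Proof.
subst e'; rewrite (Prop_irrelevance HA erefl) /=.
by rewrite (Prop_irrelevance HB HC).
Qed.

Definition ebar (e : edge G) : hom (Ge D e) (Ge D (bar e)) :=
  gcast (esym (Ge_bar D e)).

Lemma gcast_comp (A B C : groupoid) (E : A = B) (F : B = C) :
  (forall x, gcast F (gcast E x) = gcast (etrans E F) x) /\
  (forall x, hunit (gcast F) (hunit (gcast E) x) = hunit (gcast (etrans E F)) x).
Proof. by case: C / F; case: B / E. Qed.

Lemma alpha_org_bar e g :
  alpha_org D (bar e) (ebar e g) = flip D e (alpha D e g).
Proof.
rewrite /alpha_org /= /ebar (gcast_comp _ _).1 /flip.
exact: (alpha_cast (barK e) _ _ _).1.
Qed.

Lemma alpha_org_bar_unit e u :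
  hunit (alpha_org D (bar e)) (hunit (ebar e) u)
  = hunit (flip D e) (hunit (alpha D e) u).
Proof.
rewrite /alpha_org /= /ebar (gcast_comp _ _).2 /flip.
exact: (alpha_cast (barK e) _ _ _).2.
Qed.

(* The equivalence relation on the disjoint union of the G_v^(0) generated by
   the phi_e, e in T^1. *)
Definition tunit := {v : vert G & unitv v}.
Definition tu v (x : unitv v) : tunit := existT _ v x.

Definition tree_step (a b : tunit) : Prop :=
  exists e (x : unitv (org e)), [/\ sedge T e, a = tu x & b = tu (phi x)].

Definition tree_equiv : tunit -> tunit -> Prop :=
  clos_refl_sym_trans tunit tree_step.

Lemma tree_path v w : exists2 s, gpath v s w & all (fun e => `[< sedge T e >]) s.
Proof.
have [[[_ conn] _] ET] := maxT.
have inT u : svert T u by rewrite ET.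
have [s Hs] := conn (exist _ v (inT v)) (exist _ w (inT w)).
exists (map (@sval _ _) s); last first.
  by elim: s {Hs} => //= -[e He] s IH; rewrite IH andbT; apply/asboolP.
move: v Hs; elim: s => [|[e He] s IH] v /=; first by move=> [].
case=> -[<-] H; split=> //.
apply: IH; suff <- : @sub_org _ T (exist _ e He) = exist _ (org e) (inT (org e)) by [].
exact: eq_exist.
Qed.

Lemma tree_equiv_path v s w (x : unitv v) : gpath v s w ->
  all (fun e => `[< sedge T e >]) s -> exists y : unitv w, tree_equiv (tu x) (tu y).
Proof.
elim: s v x => [|e s IH] v x /=.
  by move=> E _; subst w; exists x; apply: rst_refl.
case=> E; subst v => Hs /andP [/asboolP eT sT].
have [x' Ex] := phi_surj x; have [y Hy] := IH _ x' Hs sT.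
exists y; apply: rst_trans Hy; apply: rst_sym; apply: rst_step.
by exists e, x'; rewrite Ex.
Qed.

Lemma tau_ex v (x : unitv v) :
  exists y : unitv root, tree_equiv (tu x) (tu y).
Proof. by have [s Hs sT] := tree_path v root; apply: tree_equiv_path Hs sT. Qed.

(* tau x is the representative of x in X = G_root^(0); it is unique by
   [tree_equiv_root] below. *)
Definition tau v (x : unitv v) : unitv root := projT1 (cid (tau_ex x)).

Lemma tauP v (x : unitv v) : tree_equiv (tu x) (tu (tau x)).
Proof. by rewrite /tau; case: cid. Qed.

Lemma tu_inj v : injective (@tu v).
Proof.
move=> x y E.
have K (a b : tunit) (F : a = b) : exists H : projT1 a = projT1 b,
    eq_rect _ (fun u => unitv u) (projT2 a) _ H = projT2 b.
  by subst b; exists erefl.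
have [H /=] := K _ _ E.
by rewrite (Prop_irrelevance H erefl).
Qed.

Lemma tu_flip e (x : unitv (tgt e)) : tu (hunit (flip D e) x) = tu x.
Proof.
rewrite /flip; move: (esym (org_bar e)).
by move: (org (bar e)) => w E; subst w.
Qed.

Lemma tu_phi_bar e (x : unitv (org e)) :
  tu (phi (hunit (flip D e) (phi x))) = tu x.
Proof.
have [u <-] := alpha_org_wide x.
rewrite phiE -alpha_org_bar_unit phiE /alpha_org /=.
move: (tgt_bar e) (hunit (alpha D _) _).
by move: (tgt (bar e)) (org e) => a b E z; subst b.
Qed.

Fixpoint transport (s : seq (edge G)) (a b : tunit) : Prop :=
  if s is e :: s' then
    exists2 x : unitv (org e), a = tu (phi x) & transport s' (tu x) b
  else a = b.

Lemma tu_phi_inj e (x y : unitv (org e)) : tu (phi x) = tu (phi y) -> x = y.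
Proof. by move/tu_inj/phi_inj. Qed.

Lemma transport_cat s1 s2 a b : transport (s1 ++ s2) a b <->
  exists2 c, transport s1 a c & transport s2 c b.
Proof.
elim: s1 a => [|e s1 IH] a /=; first by split=> [H|[c <-]] //; exists a.
split=> [[x Ex /IH [c H1 H2]]|[c [x Ex H1] H2]].
  by exists c => //; exists x.
by exists x => //; apply/IH; exists c.
Qed.

Lemma transport_backtrack e s a b :
  transport (e :: bar e :: s) a b -> transport s a b.
Proof.
case=> x -> [y Exy] H; suff <- : tu y = tu (phi x) by [].
rewrite -(tu_flip (phi x)); congr tu; apply: tu_phi_inj.
by rewrite -Exy tu_phi_bar.
Qed.

Lemma transport_rev e s a b : transport s a b -> forall x : unitv (org e),
  b = tu x -> exists2 c, c = tu (phi x) & transport (rcons s (bar e)) a c.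
Proof.
move=> H x Eb; exists (tu (phi x)) => //.
rewrite -cats1; apply/transport_cat; exists b => //=.
by exists (hunit (flip D e) (phi x)); rewrite ?tu_phi_bar ?tu_flip.
Qed.

Lemma tree_equiv_transport a b : tree_equiv a b ->
  exists2 s, all (fun e => `[< sedge T e >]) s & transport s a b.
Proof.
have barT e : `[< sedge T e >] -> `[< sedge T (bar e) >].
  by move=> /asboolP H; apply/asboolP; apply: sedge_bar.
elim=> {a b} [a b [e [x [eT -> ->]]]|a|a b _ [s sT H]|a b c _ [s sT H] _ [t tT K]].
- exists [:: bar e] => /=; first by rewrite barT //; apply/asboolP.
  by exists (hunit (flip D e) (phi x)); rewrite ?tu_phi_bar ?tu_flip.
- by exists [::].
- exists (rev (map (@bar G) s)).
    rewrite all_rev all_map; apply: sub_all sT => e; exact: barT.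
  elim: s a {sT} H => [|e s IH] a /=; first by move=> ->.
  case=> x -> /IH H; rewrite rev_cons.
  by have [c ->] := transport_rev (e := e) H erefl.
- exists (s ++ t); first by rewrite all_cat sT tT.
  by apply/transport_cat; exists b.
Qed.

Lemma transport_gpath v (x : unitv v) s w (y : unitv w) :
  transport s (tu x) (tu y) -> gpath v s w.
Proof.
elim: s v x => [|e s IH] v x /=; first by move/(congr1 (@projT1 _ _)).
by case=> z E /IH; split=> //; move/(congr1 (@projT1 _ _)): E.
Qed.

Lemma backtracking_split (K : graph) (s : seq (edge K)) : ~ no_backtracking s ->
  exists s1 e s2, s = s1 ++ e :: bar e :: s2.
Proof.
elim: s => [|e s IH] //= /not_andP [].
  case: s {IH} => // f s /contrapT ->; by exists [::], e, s.
by move/IH => [s1 [f [s2 ->]]]; exists (e :: s1), f, s2.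
Qed.

Lemma tree_closed v s : gpath v s v -> all (fun e => `[< sedge T e >]) s ->
  no_backtracking s -> s = [::].
Proof.
have [[_ cyc] ET] := maxT.
have inT u : svert T u by rewrite ET.
move=> H sT nb.
have [s' Es] : exists s' : seq (sub_edge T), s = map (@sval _ _) s'.
  elim: s sT {H nb} => [|e s IH] /=; first by exists [::].
  by case/andP => /asboolP eT /IH [s' ->]; exists (exist _ e eT :: s').
rewrite {s sT}Es in H nb *.
suff -> : s' = [::] by [].
apply: (cyc (exist _ v (inT v))).
  suff lift a b : gpath a (map (@sval _ _) s') b ->
      @gpath (graph_of_subgraph T) (exist _ a (inT a)) s' (exist _ b (inT b)).
    exact: lift.
  elim: s' a {nb H} => [|[e eT] s' IH] a /=; first by move=> E; subst b.
  case=> Ea /IH H; split; first exact: eq_exist.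
  suff -> : @sub_org _ T (exist _ e eT) = exist _ (org e) (inT (org e)) by [].
  exact: eq_exist.
elim: s' nb {H} => [|e s' IH] //= [ne /IH nb]; split=> //.
case: s' ne {IH nb} => //= f _ ne E; apply: ne.
by rewrite E.
Qed.

Lemma tree_equiv_root (v : vert G) (x y : unitv v) :
  tree_equiv (tu x) (tu y) -> x = y.
Proof.
move=> /tree_equiv_transport [s sT H].
move: {2}(size s) (leqnn (size s)) => n.
elim: n s sT H => [|n IH] s sT H.
  by rewrite leqn0 => /nilP Es; move: H; rewrite Es => /tu_inj.
have [nb _|/backtracking_split [s1 [e [s2 Es]]]] := pselect (no_backtracking s).
  have Es := tree_closed (transport_gpath H) sT nb.
  by move: H; rewrite Es => /tu_inj.
move=> Hn; subst s.
apply: (IH (s1 ++ s2)).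
- by move: sT; rewrite !all_cat /= => /and4P [-> _ _ ->].
- move/transport_cat: H => [c H1 /transport_backtrack H2].
  by apply/transport_cat; exists c.
- by move: Hn; rewrite !size_cat /= !addnS ltnS => /ltnW.
Qed.

Lemma tree_equiv_tau v (x : unitv v) w (y : unitv w) :
  tree_equiv (tu x) (tu y) <-> tau x = tau y.
Proof.
split=> H.
  apply: tree_equiv_root; apply: rst_trans (tauP y).
  by apply: rst_trans H; apply: rst_sym; apply: tauP.
by apply: rst_trans (tauP x) _; rewrite H; apply: rst_sym; apply: tauP.
Qed.

Lemma tau_root (x : unitv root) : tau x = x.
Proof. by apply: tree_equiv_root; apply: rst_sym; apply: tauP. Qed.

Lemma tau_inj v : injective (@tau v).
Proof. by move=> x y /tree_equiv_tau /tree_equiv_root. Qed.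

Lemma tau_surj v (x : unitv root) : exists y : unitv v, tau y = x.
Proof.
have [s Hs sT] := tree_path root v.
have [y Hy] := tree_equiv_path x Hs sT.
by exists y; rewrite -(tau_root x); apply/tree_equiv_tau; apply: rst_sym.
Qed.

(* [GSym e x] is the symbol (phi_e(x), x). *)
Inductive pi1_gen :=
| GArr v (g : arr (Gv D v))
| GSym e (x : unitv (org e)).

Definition gen_rng (a : pi1_gen) : unitv root :=
  match a with GArr v g => tau (rng g) | GSym e x => tau (phi x) end.
Definition gen_src (a : pi1_gen) : unitv root :=
  match a with GArr v g => tau (src g) | GSym e x => tau x end.

Local Notation "[ 'arr' g ]" := (GArr g, false).
Local Notation "[ 'sym' e , x ]" := (@GSym e x, false).
Local Notation "[ 'symV' e , x ]" := (@GSym e x, true).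

Inductive pi1_rel : word pi1_gen -> word pi1_gen -> Prop :=
| rel_mul v (g h : arr (Gv D v)) : src g = rng h ->
    pi1_rel [:: [arr g]; [arr h]] [:: [arr mul g h]]
| rel_unit v (y : unitv v) : pi1_rel [:: [arr idn y]] [::]
| rel_symV e (x : unitv (org e)) :
    pi1_rel [:: [symV e, x]] [:: [sym bar e, hunit (flip D e) (phi x)]]
| rel_R1 e (x : unitv (org e)) : sedge T e -> pi1_rel [:: [sym e, x]] [::]
| rel_R2 e (g : arr (Ge D e)) :
    pi1_rel
      [:: [sym e, hunit (alpha_org D e) (rng g)];
          [arr alpha_org D e g];
          [sym bar e, hunit (flip D e) (hunit (alpha D e) (src g))]]
      [:: [arr alpha D e g]].

Definition pi1 : groupoid := presented_groupoid gen_rng gen_src pi1_rel.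

Definition vincl v (g : arr (Gv D v)) : arr pi1 :=
  pgen gen_rng gen_src pi1_rel (GArr g).
Definition symb e (x : unitv (org e)) : arr pi1 :=
  pgen gen_rng gen_src pi1_rel (GSym x).

Definition coset (p : arr pi1) v (K : set (arr (Gv D v))) : set (arr pi1) :=
  [set q | exists k, [/\ K k, src p = tau (rng k) & q = mul p (vincl k)]].

Lemma emul_ex e (p : arr pi1) : exists y : unitv (org e), tau (phi y) = src p.
Proof.
have [z <-] := tau_surj (tgt e) (src p).
by have [y <-] := phi_surj z; exists y.
Qed.

(* p e = p (phi_e(y), y), where y is the unit with tau(phi_e(y)) = s(p) *)
Definition emul (p : arr pi1) (e : edge G) : arr pi1 :=
  mul p (symb (projT1 (cid (emul_ex e p)))).


(* The two sides of each relation are parallel, so the typing conditions of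
   [weq_step] discard none of the relations. *)
Lemma pi1_rel_wpath u v : pi1_rel u v -> exists x y,
  wpath gen_rng gen_src x u y /\ wpath gen_rng gen_src x v y.
Proof.
have flipE e (x : unitv (tgt e)) : tau (hunit (flip D e) x) = tau x.
  by apply/tree_equiv_tau; rewrite tu_flip; apply: rst_refl.
case=> {u v} [v g h gh|v y|e x|e x eT|e g].
- exists (tau (rng g)), (tau (src h)).
  by rewrite /= /lrg /lsr /= gh rng_mul ?src_mul.
- by exists (tau y), (tau y); rewrite /= /lrg /lsr /= rng_idn src_idn.
- exists (tau x), (tau (phi x)); rewrite /= /lrg /lsr /= flipE; do 2 split=> //.
  by apply/tree_equiv_tau; rewrite tu_phi_bar; apply: rst_refl.
- exists (tau x), (tau x); rewrite /= /lrg /lsr /=; do 2 split=> //.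
  apply/tree_equiv_tau; apply: rst_sym; apply: rst_step.
  by exists e, x.
- exists (tau (rng (alpha D e g))), (tau (src (alpha D e g))).
  rewrite /= /lrg /lsr /= !hom_rng !hom_src flipE phiE; do 4 split=> //.
  apply/tree_equiv_tau; rewrite -phiE tu_phi_bar; exact: rst_refl.
Qed.

Lemma rng_vincl v (g : arr (Gv D v)) : rng (vincl g) = tau (rng g).
Proof. by []. Qed.
Lemma src_vincl v (g : arr (Gv D v)) : src (vincl g) = tau (src g).
Proof. by []. Qed.
Lemma rng_symb e (x : unitv (org e)) : rng (symb x) = tau (phi x).
Proof. by []. Qed.
Lemma src_symb e (x : unitv (org e)) : src (symb x) = tau x.
Proof. by []. Qed.

Lemma tau_flip e (x : unitv (tgt e)) : tau (hunit (flip D e) x) = tau x.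
Proof. by apply/tree_equiv_tau; rewrite tu_flip; apply: rst_refl. Qed.

Lemma tau_phi_bar e (x : unitv (org e)) :
  tau (phi (hunit (flip D e) (phi x))) = tau x.
Proof. by apply/tree_equiv_tau; rewrite tu_phi_bar; apply: rst_refl. Qed.

Lemma vincl_mul v (g h : arr (Gv D v)) : src g = rng h ->
  mul (vincl g) (vincl h) = vincl (mul g h).
Proof.
move=> gh; have E : src (vincl g) = rng (vincl h) by rewrite /= gh.
apply: (pcls_rel _ _ (pcls_mul E (pcls_gen _ _ _ _) (pcls_gen _ _ _ _))
  (pcls_gen _ _ _ _) (rel_mul gh)).
- by rewrite prng_mul //= rng_mul.
- by rewrite psrc_mul //= src_mul.
Qed.

Lemma vincl_idn v (y : unitv v) : vincl (idn y) = idn (tau y : gunit pi1).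
Proof.
apply: (pcls_rel _ _ (pcls_gen _ _ _ _) _ (rel_unit y)) => /=.
- by rewrite rng_idn.
- by rewrite src_idn.
- exact: weq_refl.
Qed.

Lemma symb_inv e (x : unitv (org e)) :
  inv (symb x) = symb (hunit (flip D e) (phi x)).
Proof.
apply: (pcls_rel _ _ (pcls_inv (pcls_gen _ _ _ _)) (pcls_gen _ _ _ _)
  (rel_symV x)) => /=.
- by apply/esym/tree_equiv_tau; rewrite tu_phi_bar; apply: rst_refl.
- by apply/esym/tree_equiv_tau; rewrite tu_flip; apply: rst_refl.
Qed.

Lemma symb_R1 e (x : unitv (org e)) : sedge T e ->
  symb x = idn (tau x : gunit pi1).
Proof.
move=> eT; apply: (pcls_rel _ _ (pcls_gen _ _ _ _) _ (rel_R1 x eT)) => //=.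
- by apply/esym/tree_equiv_tau; apply: rst_step; exists e, x.
- exact: weq_refl.
Qed.

Lemma symb_R2 e (g : arr (Ge D e)) :
  mul (vincl (alpha D e g)) (symb (hunit (alpha_org D e) (src g)))
  = mul (symb (hunit (alpha_org D e) (rng g))) (vincl (alpha_org D e g)).
Proof.
set a := symb _; set b := vincl (alpha D e g); set c := symb _; set d := vincl _.
have ba : src b = rng a by rewrite /b /a src_vincl rng_symb phiE hom_src.
have cd : src c = rng d by rewrite /c /d src_symb rng_vincl hom_rng.
have da : src d = src a by rewrite /d /a src_vincl src_symb hom_src.
have dV : src d = rng (inv a) by rewrite rng_inv.
have qV : src (mul c d) = rng (inv a) by rewrite src_mul.
suff -> : b = mul (mul c d) (inv a).
  by rewrite -mul_assoc // ?src_inv // inv_mul -da -(src_mul cd) mul_idn.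
rewrite -mul_assoc //.
have iE : inv a = symb (hunit (flip D e) (hunit (alpha D e) (src g))).
  by rewrite /a symb_inv phiE.
have cV : src c = rng (mul d (inv a)) by rewrite rng_mul.
apply/esym; apply: (pcls_rel _ _ _ (pcls_gen _ _ _ _) (rel_R2 g)).
- by rewrite prng_mul // -[LHS]/(rng c) rng_symb phiE -hom_rng.
- by rewrite -[LHS]/(src (mul c (mul d (inv a)))) !src_mul // src_inv -ba.
- apply: (@pcls_mul _ _ _ _ _ c _ [:: _] _ cV); first exact: pcls_gen.
  apply: (@pcls_mul _ _ _ _ _ d _ [:: _] [:: _] dV); first exact: pcls_gen.
  rewrite iE; exact: pcls_gen.
Qed.

Lemma coset_refl (p : arr pi1) v (K : set (arr (Gv D v))) :
  wide_subgroupoid K -> coset p K p.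
Proof.
case=> _ _ KI; have [y Ey] := tau_surj v (src p).
exists (idn y); split; rewrite ?rng_idn //.
by rewrite vincl_idn Ey mul_idn.
Qed.

Lemma coset_sub (p q : arr pi1) v (K : set (arr (Gv D v))) :
  wide_subgroupoid K -> coset p K q -> coset q K `<=` coset p K.
Proof.
case=> KM _ _ [k [Kk pk ->]] _ [l [Kl + ->]].
have pk' : src p = rng (vincl k) by [].
rewrite src_mul // src_vincl => /tau_inj kl.
exists (mul k l); split; rewrite ?rng_mul //; first exact: KM.
by rewrite -vincl_mul // mul_assoc // rng_vincl -kl.
Qed.

Lemma coset_eq (p q : arr pi1) v (K : set (arr (Gv D v))) :
  wide_subgroupoid K -> coset p K q -> coset q K = coset p K.
Proof.
move=> wK H; apply/seteqP; split; first exact: coset_sub.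
apply: coset_sub => //; case: wK H => _ KI _ [k [Kk pk ->]].
have pk' : src p = rng (vincl k) by [].
exists (inv k); split; first exact: KI.
  by rewrite src_mul // rng_inv.
rewrite -mul_assoc //; last by rewrite !rng_vincl rng_inv.
by rewrite vincl_mul ?rng_inv // mul_inv vincl_idn -pk mul_idn.
Qed.

Lemma wide_setT v : wide_subgroupoid [set: arr (Gv D v)].
Proof. by split. Qed.

Lemma emulP (p : arr pi1) e : exists y : unitv (org e),
  tau (phi y) = src p /\ emul p e = mul p (symb y).
Proof. by rewrite /emul; case: cid => y Ey; exists y. Qed.

Lemma emul_coset (p q : arr pi1) e : coset p (Hsub D e) q ->
  coset (emul q e) [set: arr (Gv D (org e))]
  = coset (emul p e) [set: arr (Gv D (org e))].
Proof.
case=> _ [[g _ <-] Ep ->]; apply: (coset_eq (wide_setT _)).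
have pg : src p = rng (vincl (alpha D e g)) by [].
have [y [Ey ->]] := emulP p e.
have [z [Ez ->]] := emulP (mul p (vincl (alpha D e g))) e.
have {}Ey : y = hunit (alpha_org D e) (rng g).
  by apply: phi_inj; apply: (@tau_inj (tgt e)); rewrite Ey Ep phiE hom_rng.
have {}Ez : z = hunit (alpha_org D e) (src g).
  apply: phi_inj; apply: (@tau_inj (tgt e)).
  by rewrite Ez src_mul // src_vincl phiE hom_src.
have py : src p = rng (symb y) by rewrite Ey rng_symb phiE Ep hom_rng.
have yg : src (symb y) = rng (vincl (alpha_org D e g)).
  by rewrite src_symb rng_vincl Ey hom_rng.
exists (alpha_org D e g); split=> //; first by rewrite src_mul.
rewrite -!mul_assoc // ?Ey ?Ez ?symb_R2 //.
by rewrite src_vincl rng_symb phiE hom_src.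
Qed.

Variable P : set (edge G).
Hypothesis orP : orientation P.

(* |e| *)
Definition eabs (e : edge G) : edge G := if e \in P then e else bar e.

(* p e^(1 - epsilon(e)) and p e^(- epsilon(e)) *)
Definition eorg (p : arr pi1) e : arr pi1 := if e \in P then emul p e else p.
Definition etgt (p : arr pi1) e : arr pi1 :=
  if e \in P then p else emul p (bar e).

Definition vcoset (v : vert G) (p : arr pi1) : set (arr pi1) :=
  coset p [set: arr (Gv D v)].
Definition ecoset (e : edge G) (p : arr pi1) : set (arr pi1) :=
  coset p (Hsub D (eabs e)).

Definition bs_vert := {c : vert G * set (arr pi1) | exists p, c.2 = vcoset c.1 p}.
Definition bs_edge := {c : edge G * set (arr pi1) | exists p, c.2 = ecoset c.1 p}.

(* p G_v[v] and p H_|e|[e] *)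
Definition mk_vert v p : bs_vert := exist _ (v, vcoset v p) (ex_intro _ p erefl).
Definition mk_edge e p : bs_edge := exist _ (e, ecoset e p) (ex_intro _ p erefl).

Definition vrep (c : bs_vert) : arr pi1 := projT1 (cid (svalP c)).
Definition erep (c : bs_edge) : arr pi1 := projT1 (cid (svalP c)).

(* Defined through a chosen representative; see [bs_orgE], [bs_tgtE], [bs_barE]
   and [bs_rngE] for the independence of that choice. *)
Definition bs_org (c : bs_edge) : bs_vert :=
  mk_vert (org (sval c).1) (eorg (erep c) (sval c).1).
Definition bs_tgt (c : bs_edge) : bs_vert :=
  mk_vert (tgt (sval c).1) (etgt (erep c) (sval c).1).
Definition bs_bar (c : bs_edge) : bs_edge := mk_edge (bar (sval c).1) (erep c).
Definition bs_rng (c : bs_vert) : gunit pi1 := rng (vrep c).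

Lemma eabs_bar e : eabs (bar e) = eabs e.
Proof.
rewrite /eabs; case: (orP e) => -[H1 H2].
  by rewrite (memNset H2) (mem_set H1) barK.
by rewrite (memNset H1) (mem_set H2).
Qed.

Lemma etgt_bar p e : etgt p (bar e) = eorg p e.
Proof.
rewrite /etgt /eorg; case: (orP e) => -[H1 H2].
  by rewrite (memNset H2) (mem_set H1) barK.
by rewrite (memNset H1) (mem_set H2).
Qed.

Lemma eorg_bar p e : eorg p (bar e) = etgt p e.
Proof. by rewrite -etgt_bar barK. Qed.

Lemma ecoset_bar p e : ecoset (bar e) p = ecoset e p.
Proof. by rewrite /ecoset eabs_bar. Qed.

Lemma coset_sameP (p q : arr pi1) v (K : set (arr (Gv D v))) :
  wide_subgroupoid K -> coset p K = coset q K -> coset p K q.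
Proof. by move=> wK ->; apply: coset_refl. Qed.

Lemma vcoset_org e p q : ecoset e p = ecoset e q ->
  vcoset (org e) (eorg p e) = vcoset (org e) (eorg q e).
Proof.
move=> /(coset_sameP (wideD _)); rewrite /ecoset /eorg /eabs.
case: (e \in P) => [/emul_coset //|[_ [[g _ <-] E ->]]].
rewrite -tgt_bar; apply/esym; apply: (coset_eq (wide_setT _)).
by exists (alpha D (bar e) g).
Qed.

Lemma vcoset_tgt e p q : ecoset e p = ecoset e q ->
  vcoset (tgt e) (etgt p e) = vcoset (tgt e) (etgt q e).
Proof.
by rewrite -org_bar -!eorg_bar -ecoset_bar -(ecoset_bar q); apply: vcoset_org.
Qed.

Lemma erepE e p : ecoset e (erep (mk_edge e p)) = ecoset e p.
Proof. by rewrite /erep; case: cid. Qed.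

Lemma vrepE v p : vcoset v (vrep (mk_vert v p)) = vcoset v p.
Proof. by rewrite /vrep; case: cid. Qed.

Lemma bs_edgeP (c : bs_edge) : exists e p, c = mk_edge e p.
Proof. by case: c => -[e C] [p H]; exists e, p; apply: eq_exist; rewrite -H. Qed.

Lemma bs_vertP (c : bs_vert) : exists v p, c = mk_vert v p.
Proof. by case: c => -[v C] [p H]; exists v, p; apply: eq_exist; rewrite -H. Qed.

Lemma mk_vert_eq v w p q : v = w -> vcoset v p = vcoset v q ->
  mk_vert v p = mk_vert w q.
Proof. by move=> <- E; apply: eq_exist; rewrite E. Qed.

Lemma mk_edge_eq e f p q : e = f -> ecoset e p = ecoset e q ->
  mk_edge e p = mk_edge f q.
Proof. by move=> <- E; apply: eq_exist; rewrite E. Qed.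

Lemma bs_orgE e p : bs_org (mk_edge e p) = mk_vert (org e) (eorg p e).
Proof. by apply: mk_vert_eq => //; apply: vcoset_org; apply: erepE. Qed.

Lemma bs_tgtE e p : bs_tgt (mk_edge e p) = mk_vert (tgt e) (etgt p e).
Proof. by apply: mk_vert_eq => //; apply: vcoset_tgt; apply: erepE. Qed.

Lemma bs_barE e p : bs_bar (mk_edge e p) = mk_edge (bar e) p.
Proof. by apply: mk_edge_eq => //=; rewrite !ecoset_bar erepE. Qed.

Lemma bs_rngE v p : bs_rng (mk_vert v p) = rng p.
Proof.
rewrite /bs_rng; have /(coset_sameP (wide_setT _)) := esym (vrepE v p).
by case=> k [_ E ->]; rewrite rng_mul.
Qed.

Lemma rng_emul p e : rng (emul p e) = rng p.
Proof. by have [y [E ->]] := emulP p e; rewrite rng_mul. Qed.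

Lemma rng_eorg p e : rng (eorg p e) = rng p.
Proof. by rewrite /eorg; case: ifP => // _; rewrite rng_emul. Qed.

Lemma rng_etgt p e : rng (etgt p e) = rng p.
Proof. by rewrite -eorg_bar rng_eorg. Qed.

Lemma bs_bar_neq c : bs_bar c <> c.
Proof. by move=> /(congr1 (fun c => (sval c).1)) /=; apply: bar_neq. Qed.

Lemma bs_barK c : bs_bar (bs_bar c) = c.
Proof. by have [e [p ->]] := bs_edgeP c; rewrite !bs_barE barK. Qed.

Lemma bs_tgt_bar c : bs_tgt (bs_bar c) = bs_org c.
Proof.
have [e [p ->]] := bs_edgeP c.
by rewrite bs_barE bs_tgtE bs_orgE etgt_bar tgt_bar.
Qed.

Definition bass_serre_forest : graph := Graph bs_bar_neq bs_barK bs_tgt_bar.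

Section Component.
Variable x : gunit pi1.

Lemma bs_rng_tgt c : bs_rng (bs_org c) = x -> bs_rng (bs_tgt c) = x.
Proof.
have [e [p ->]] := bs_edgeP c.
by rewrite bs_orgE bs_tgtE !bs_rngE rng_eorg rng_etgt.
Qed.

Lemma bs_rng_bar c : bs_rng (bs_org c) = x -> bs_rng (bs_org (bs_bar c)) = x.
Proof. by move=> /bs_rng_tgt; rewrite -bs_tgt_bar bs_barK. Qed.

Definition bs_component : subgraph bass_serre_forest :=
  @Subgraph bass_serre_forest (bs_rng @^-1` [set x])
    (bs_org @^-1` (bs_rng @^-1` [set x])) (fun _ h => h) bs_rng_tgt bs_rng_bar.

End Component.

End FundamentalGroupoid.

(* Main.v *)
Require Import Defs.
From mathcomp Require Import all_boot.
From mathcomp Require Import boolp classical_sets.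
Import Defs.

(** The proof detects cycles by potentials with values in Z/2, written as
    booleans under exclusive or.  Say that a labelling c of the edges by
    booleans, with c (bar e) = c e, has the potential F when
    c e = F (org e) (+) F (tgt e).  A graph in which every such labelling has a
    potential has no cycle: a shortest nontrivial closed path without backtracking
    crosses each of its edges only once, so the labelling that marks one of its
    edges has sum 1 along the path, whereas the sum of a labelling with a potential
    telescopes to 0 ([acyclic_of_potentials]).  Conversely, a tree has all
    potentials ([tree_potential]).

    Potentials exist on the Bass-Serre forest because of the presentation of the
    fundamental groupoid.  In any presented groupoid, a labelling of the
    Cayley graph whose sums along the two sides of each relation agree, from
    every starting point, is the variation of a function
    ([cayley_potential]).  Given a labelling c of the forest, each translate by
    p of the tree T has a potential gam p, and a Cayley label is obtained by
    adding up c along the path of the forest from p G_root to (p a) G_root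
    associated with a generator a: go inside the translated tree to the place
    where a acts, cross the edge of a if a is a symbol (phi_e(y), y), and return
    inside the tree translated by p a.  Leaving out the values of gam p and
    gam (p a) at the root, which only changes f below by the function
    p |-> gam p root, gives [gen_label].  The relations of the vertex
    groupoids are compatible with this label since gam telescopes; (R1) says
    that an edge of T is crossed inside the tree; and (R2) holds because both
    of its symbols cross the same edge of the forest, p H_e = p alpha_e(g) H_e
    ([crossing_slide], [gen_label_rel]).  The resulting function f on the
    fundamental groupoid gives the potential f p (+) gam p v on the vertex
    p G_v[v] ([forest_potential]).

    For connectedness, all the p G_v[v] with p fixed lie on a translate of T,
    and a word for p gives a chain of such translates from the unit
    r(p) to p, consecutive ones sharing a vertex or being joined by an edge
    ([linked_gen], [linked_base]). *)

Set Implicit Arguments.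
Unset Strict Implicit.
Unset Printing Implicit Defensive.

(** * Potentials and cycles in graphs *)

Definition potential (K : graph) (c : edge K -> bool) (F : vert K -> bool) :=
  forall e, F (org e) (+) F (tgt e) = c e.

Section Graphs.
Variable K : graph.
Implicit Types (u v w : vert K) (e f : edge K) (s t : seq (edge K)).

Lemma gpath_cat v s t w :
  gpath v (s ++ t) w <-> exists2 u, gpath v s u & gpath u t w.
Proof.
elim: s v => [|e s IH] v /=; first by split=> [H|[u <-]] //; exists v.
split=> [[-> /IH [u H1 H2]]|[u [-> H1] H2]]; first by exists u.
by split=> //; apply/IH; exists u.
Qed.

Lemma gpath_rev v s w : gpath v s w -> gpath w (rev (map (@bar K) s)) v.
Proof.
elim: s v => [|e s IH] v //= [<- /IH H].
rewrite rev_cons -cats1; apply/gpath_cat; exists (org e) => //=.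
by rewrite tgt_bar org_bar.
Qed.

Lemma no_backtracking_catl s t : no_backtracking (s ++ t) -> no_backtracking s.
Proof.
elim: s => [|e s IH] //= [H /IH nb]; split=> //.
by case: s H {IH nb}.
Qed.

Lemma potential_path c F v s w : potential c F -> gpath v s w ->
  \big[addb/false]_(e <- s) c e = F v (+) F w.
Proof.
move=> HF; elim: s v => [|e s IH] v /=; first by move=> ->; rewrite big_nil addbb.
by case=> <- /IH H; rewrite big_cons H -HF; do 3 case: (F _).
Qed.

(** A shortest nontrivial closed path without backtracking crosses its first
    edge once, in either direction: any second crossing would cut off a
    shorter one.  The labelling that marks this edge then sums to true along the
    path, so it has no potential. *)
Lemma acyclic_of_potentials :
  (forall c, (forall e, c (bar e) = c e) -> exists F, potential c F) ->
  forall v s, gpath v s v -> no_backtracking s -> s = [::].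
Proof.
move=> pot v s; have [n] := ubnP (size s); elim: n v s => // n IH v [|e s] //.
rewrite ltnS /= => sn [Ev H] [He nb].
pose c f := `[< f = e \/ f = bar e >].
have [|cs] := boolP (has c s).
  move=> cs; move: sn H He nb; case/split_find: cs => f s1 s2 /asboolP cf _.
  rewrite cat_rcons => sn H He nb.
  have /gpath_cat [u H1 [Eu _]] := H.
  have sz : (size s1).+1 < n.
    by apply: leq_ltn_trans _ sn; rewrite size_cat /= addnS ltnS leq_addr.
  case: cf => Ef; subst f.
    (* crossed again in the same direction: cut just before the second time *)
    have : e :: s1 = [::]; last by [].
    apply: (IH v) => //=; first by split=> //; rewrite -Ev Eu.
    exact: (no_backtracking_catl (s := e :: s1) (conj He nb)).
  (* crossed backwards: s1 is closed, and if it is empty then s backtracks *)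
  have E1 : s1 = [::].
    apply: (IH (org e)); first exact: ltnW; last exact: no_backtracking_catl nb.
    by rewrite -{2}(tgt_bar e) Eu.
  by rewrite E1 in He; case: He.
have [|F HF] := pot c.
  move=> f; apply: asbool_equiv_eq; split=> -[E|E].
  - by right; rewrite -E barK.
  - by left; rewrite -(barK f) E barK.
  - by right; rewrite E.
  - by left; rewrite E barK.
have /(potential_path HF) : gpath v (e :: s) v by [].
rewrite addbb big_cons; have -> : c e by apply/asboolP; left.
suff -> : \big[addb/false]_(f <- s) c f = false by [].
elim: s cs {sn H He nb} => [|f s IHs] /=; first by rewrite big_nil.
by rewrite negb_or big_cons => /andP [/negPf -> /IHs].
Qed.

(** Cancelling e against bar e does not change the sum, and in a tree a closed
    path cancels down to the empty one. *)
Lemma tree_cycle_sum c v s : tree K -> (forall e, c (bar e) = c e) ->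
  gpath v s v -> \big[addb/false]_(e <- s) c e = false.
Proof.
move=> [_ cyc] cB; have [n] := ubnP (size s); elim: n s => // n IH s sn H.
have [nb|/backtracking_split [s1 [e [s2 Es]]]] := pselect (no_backtracking s).
  by rewrite (cyc _ _ H nb) big_nil.
rewrite Es in sn H *.
have -> : \big[addb/false]_(f <- s1 ++ e :: bar e :: s2) c f
        = \big[addb/false]_(f <- s1 ++ s2) c f.
  by rewrite !big_cat !big_cons /= cB addKb.
apply: IH.
  by move: sn; rewrite !size_cat /= !addnS ltnS => /ltnW.
apply/gpath_cat; have /gpath_cat [u H1 /= [Eu [Eu' H2]]] := H.
by exists u => //; rewrite -Eu -org_bar.
Qed.

(** The potential of v is the sum along any path from v to a base point. *)
Lemma tree_potential c : tree K -> (forall e, c (bar e) = c e) ->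
  exists F, potential c F.
Proof.
move=> tK cB; have [[[b] conn] _] := tK.
have [r Hr] := choice (fun v => conn v b).
exists (fun v => \big[addb/false]_(e <- r v) c e) => e.
have /tree_cycle_sum :
    gpath b (rev (map (@bar K) (r (tgt e))) ++ e :: r (org e)) b.
  by apply/gpath_cat; exists (tgt e); first exact/gpath_rev.
move=> /(_ _ tK cB).
rewrite big_cat big_cons big_rev big_map /=.
under eq_bigr do rewrite cB.
set F := fun v => \big[addb/false]_(f <- r v) c f.
by rewrite -/(F (tgt e)) -/(F (org e)); case: (F _); case: (c e); case: (F _).
Qed.

Definition linked v w := exists s, gpath v s w.

Lemma linked_refl v : linked v v. Proof. by exists [::]. Qed.

Lemma linked_sym v w : linked v w -> linked w v.
Proof. by move=> [s /gpath_rev H]; exists (rev (map (@bar K) s)). Qed.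

Lemma linked_trans u v w : linked u v -> linked v w -> linked u w.
Proof.
by move=> [s Hs] [t Ht]; exists (s ++ t); apply/gpath_cat; exists v.
Qed.

Lemma linked_edge e : linked (tgt e) (org e). Proof. by exists [:: e]. Qed.

Variable S : subgraph K.

Lemma acyclic_subgraph :
  (forall v s, gpath v s v -> no_backtracking s -> s = [::]) ->
  forall (v : vert (graph_of_subgraph S)) (s : seq (edge (graph_of_subgraph S))),
    gpath v s v -> no_backtracking s -> s = [::].
Proof.
move=> cyc v s H nb; suff : map sval s = [::] by case: s {H nb}.
apply: (cyc (sval v)).
  move: {2 4}v H; elim: s {nb} v => [|e s IH] v w /=; first by move->.
  by case=> <- /IH.
elim: s nb {H} => [|e s IH] //= [ne /IH nb]; split=> //.
by case: s ne {IH nb} => //= -[f Sf] _ ne E; apply: ne; apply: eq_exist.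
Qed.

Lemma connected_subgraph (b : vert K) : svert S b ->
  (forall e, svert S (tgt e) -> sedge S e) ->
  (forall v, svert S v -> linked b v) -> connected (graph_of_subgraph S).
Proof.
move=> Sb full conn; split; first by constructor; exists b.
case=> v Sv [w Sw].
have [s Hs] := linked_trans (linked_sym (conn _ Sv)) (conn _ Sw).
elim: s v Sv Hs => [|e s IH] v Sv /=.
  by move=> E; exists [::]; apply: eq_exist.
case=> E; subst v => H; have Se := full _ Sv.
(* the membership proof carried by the origin of e in the subgraph *)
have [t Ht] := IH _ (sedge_org (svalP (exist _ e Se))) H.
by exists (exist _ e Se :: t); split; first exact: eq_exist.
Qed.

End Graphs.

Lemma mulgK (B : groupoid) (p g : arr B) : src p = rng g ->
  mul (mul p g) (inv g) = p.
Proof. by move=> pg; rewrite -mul_assoc ?rng_inv // mul_inv -pg mul_idn. Qed.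

Lemma mulgVK (B : groupoid) (p g : arr B) : src p = src g ->
  mul (mul p (inv g)) g = p.
Proof.
by move=> pg; rewrite -mul_assoc ?src_inv ?rng_inv // inv_mul -pg mul_idn.
Qed.

(** * Labellings of the Cayley graph of a presented groupoid *)

Section Cayley.
Variables (X A : Type) (rg sr : A -> X) (rel : word A -> word A -> Prop).
Local Notation Pi := (presented_groupoid rg sr rel).
Local Notation lrg := (lrg rg sr).
Local Notation lsr := (lsr rg sr).
Local Notation wpath := (wpath rg sr).
Local Notation weq := (weq rg sr rel).
Implicit Types (p : arr Pi) (u v w : word A).

Lemma wpath_end x w y y' : wpath x w y -> wpath x w y' -> y = y'.
Proof. by elim: w x => [|l w IH] x /=; [move=> <-|case=> _ H [_ /(IH _ H)]]. Qed.

Lemma wpath_start x x' w y : wpath x w y -> wpath x' w y -> x = x'.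
Proof. by case: w => [|l w] /=; [move=> -> ->|case=> -> _ []]. Qed.

Lemma pcls_inhabited (a : arr Pi) :
  exists2 w, pcls a w & wpath (rng a) w (src a).
Proof. by case: a => x y C [w H E]; exists w; rewrite //= E; apply: weq_refl. Qed.

Lemma pcls_weq (a : arr Pi) u v : pcls a u -> pcls a v ->
  weq (rng a) (src a) u v.
Proof.
case: a => x y C [w H E] /=; rewrite E => Hu Hv.
exact: weq_trans (weq_sym Hu) Hv.
Qed.

Lemma pclsE (a : arr Pi) w : pcls a w -> weq (rng a) (src a) w = pcls a.
Proof. by case: a => x y C [u H E] /=; rewrite E => Hw; rewrite (weq_cls Hw). Qed.

Definition letter_arr (l : letter A) : arr Pi :=
  if l.2 then inv (pgen rg sr rel l.1) else pgen rg sr rel l.1.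

Lemma rng_letter l : rng (letter_arr l) = lrg l. Proof. by case: l => a []. Qed.
Lemma src_letter l : src (letter_arr l) = lsr l. Proof. by case: l => a []. Qed.

Definition walk (p : arr Pi) (w : word A) : arr Pi :=
  foldl (fun q l => mul q (letter_arr l)) p w.

Lemma letter_arrE l (H : wpath (lrg l) [:: l] (lsr l)) :
  letter_arr l = pclass rel H.
Proof.
by case: l H => a [] H; rewrite /letter_arr /= /pgen ?pinvE;
  apply: pclass_eq; apply: weq_refl.
Qed.

Lemma walkE p w y (H : wpath (src p) w y) : walk p w = mul p (pclass rel H).
Proof.
elim: w p H => [|l w IH] p H.
  by case: y / H; apply/esym/(@mul_idn Pi p).
rewrite -[walk p (l :: w)]/(walk (mul p (letter_arr l)) w).
have [E H2] := H.
have H1 : wpath (lrg l) [:: l] (lsr l) by [].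
have pl : src p = rng (letter_arr l) by rewrite rng_letter.
have H3 : wpath (src (mul p (letter_arr l))) w y by rewrite src_mul // src_letter.
(* the source of the walk is equal, but not convertible, to lsr l *)
have E3 z (K : wpath z w y) : z = lsr l ->
    pclass rel K = pclass rel H2 :> arr Pi.
  by move=> Ez; subst z; apply: parr_eq.
have E4 : pclass rel H = mul (letter_arr l) (pclass rel H2 : arr Pi) :> arr Pi.
  rewrite (letter_arrE H1) [RHS]pmulE.
  by apply: parr_eq; rewrite //= E.
by rewrite (IH _ H3) (E3 _ H3) ?E4 ?(@mul_assoc Pi) // ?src_mul ?src_letter //.
Qed.

Lemma walk_idn p w : pcls p w -> walk (idn (rng p)) w = p.
Proof.
move=> Hp; have [Hw _] := weq_wpath (pcls_weq Hp Hp).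
rewrite (walkE (p := idn (rng p)) Hw) -[RHS](@idn_mul Pi); congr (@mul Pi _ _).
by apply: parr_eq => //=; apply: pclsE.
Qed.

(** [lam p a] labels the edge of the Cayley graph from p to p a; a formal
    inverse of a is read from p as the edge from p a^-1, traversed backwards. *)
Variable lam : arr Pi -> A -> bool.

Definition letter_label (p : arr Pi) (l : letter A) : bool :=
  if l.2 then lam (mul p (inv (pgen rg sr rel l.1))) l.1 else lam p l.1.

Fixpoint walk_sum (p : arr Pi) (w : word A) : bool :=
  if w is l :: w' then letter_label p l (+) walk_sum (mul p (letter_arr l)) w'
  else false.

Lemma walk_sum_cat p u v :
  walk_sum p (u ++ v) = walk_sum p u (+) walk_sum (walk p u) v.
Proof. by elim: u p => [|l u IH] p //=; rewrite IH addbA. Qed.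

Hypothesis lam_rel : forall (p : arr Pi) u v y, rel u v ->
  wpath (src p) u y -> wpath (src p) v y -> walk_sum p u = walk_sum p v.

Lemma walk_sum_step p u v y : wstep rel u v ->
  wpath (src p) u y -> wpath (src p) v y -> walk_sum p u = walk_sum p v.
Proof.
case=> {u v} [l|u v R]; last exact: lam_rel R.
case=> pl _ _; have {}pl : src p = rng (letter_arr l) by rewrite rng_letter.
rewrite /= addbF; case: l pl => a [] pl; rewrite /letter_label /=.
  exact: addbb.
by have /= -> := mulgK pl; rewrite addbb.
Qed.

Lemma walk_sum_weq p x y u v : src p = x -> weq x y u v ->
  walk_sum p u = walk_sum p v.
Proof.
move=> px; elim=> // {u v} [u v w _ -> _ ->|w1 u v w2 S H H'] //.
have [z [H1 Hz]] := (wpath_cat _ _ _ _ _ _).1 H.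
have [z' [H1' Hz']] := (wpath_cat _ _ _ _ _ _).1 H'.
have Ez := wpath_end H1 H1'; subst z'.
have [t [Hu H2]] := (wpath_cat _ _ _ _ _ _).1 Hz.
have [t' [Hv H2']] := (wpath_cat _ _ _ _ _ _).1 Hz'.
have Et := wpath_start H2 H2'; subst t'.
subst x; have qz : src (walk p w1) = z by rewrite (walkE H1) src_mul.
rewrite !walk_sum_cat; subst z; rewrite (walk_sum_step S Hu Hv).
congr (_ (+) (_ (+) walk_sum _ _)).
rewrite (walkE Hu) (walkE Hv); congr (mul _ _); apply: pclass_eq.
by have := @weq_step _ _ rg sr _ _ _ [::] _ _ [::] S; rewrite !cats0; apply.
Qed.

(** The potential of p is the sum along a walk from the unit of its range to p.
    Words for the same p are related by elementary steps inside a context, and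
    the walks before and after the modified factor coincide, so only the factor
    itself matters ([walk_sum_weq]). *)
Lemma cayley_potential : exists f : arr Pi -> bool,
  forall p a, src p = rg a -> f (mul p (pgen rg sr rel a)) = f p (+) lam p a.
Proof.
have [r Hr] : {r : arr Pi -> word A & forall p, pcls p (r p)}.
  by apply: choice => p; have [w] := pcls_inhabited p; exists w.
exists (fun p => walk_sum (idn (rng p)) (r p)) => p a pa.
have pa' : src p = rng (pgen rg sr rel a) by [].
have H := pcls_mul pa' (Hr p) (pcls_gen rg sr rel a).
rewrite -(walk_sum_weq (x := rng (mul p (pgen rg sr rel a))) _
  (pcls_weq H (Hr _))) //.
rewrite walk_sum_cat rng_mul // walk_idn //.
by rewrite /= addbF.
Qed.

End Cayley.

(** * Crossing an edge of the Bass-Serre forest *)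

Section Forest.
Variables (G : graph) (D : graph_of_groupoids G).
Hypothesis wideD : forall e : edge G, wide_subgroupoid (Hsub D e).
Variables (T : subgraph G) (root : vert G).
Hypothesis maxT : maximal_subtree T.
Variable P : set (edge G).
Hypothesis orP : orientation P.

Local Notation Pi := (pi1 wideD maxT root).
Local Notation unitv v := (gunit (Gv D v)).
Local Notation tau := (tau wideD maxT root).
Local Notation phi := (phi wideD).
Local Notation vincl := (vincl wideD maxT root).
Local Notation symb := (symb wideD maxT root).
Local Notation mk_edge := (mk_edge P).
Local Notation forest := (bass_serre_forest wideD maxT root orP).
Local Notation gen_arr :=
  (letter_arr (gen_rng wideD maxT root) (gen_src wideD maxT root) (pi1_rel wideD T)).
Implicit Types (p q : arr Pi) (v w : vert G) (e : edge G).

(** The edge over e that leads from p (phi_e(y), y) G_o(e) to p G_t(e), whose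
    coset has a different representative for each of the two orientations
    of e.  Hiding the orientation here makes the rest of the proof
    independent of it. *)
Definition crossing p e (y : unitv (org e)) : edge forest :=
  mk_edge e (if e \in P then p else mul p (symb y)).

Lemma emulE p e (y : unitv (org e)) : tau (phi y) = src p ->
  emul p e = mul p (symb y).
Proof.
by move=> Ey; have [z [+ ->]] := emulP p e; rewrite -Ey => /tau_inj /phi_inj ->.
Qed.

Lemma symbK p e (y : unitv (org e)) : tau (phi y) = src p ->
  mul (mul p (symb y)) (symb (hunit (flip D e) (phi y))) = p.
Proof. by move=> Ey; rewrite -symb_inv mulgK. Qed.

Lemma emul_bar p e (y : unitv (org e)) : tau (phi y) = src p ->
  emul (mul p (symb y)) (bar e) = p.
Proof.
move=> Ey; rewrite (emulE (y := hunit (flip D e) (phi y))) ?symbK //.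
by rewrite tau_phi_bar src_mul ?rng_symb.
Qed.

Lemma in_orientation_bar e : (bar e \in P) = (e \notin P).
Proof.
case: (orP e) => -[H1 H2]; first by rewrite (memNset H2) (mem_set H1).
by rewrite (memNset H1) (mem_set H2).
Qed.

Lemma crossing_tgt p e (y : unitv (org e)) : tau (phi y) = src p ->
  tgt (crossing p y) = mk_vert (tgt e) p.
Proof.
move=> Ey; rewrite [LHS]bs_tgtE /etgt; case: (e \in P) => //.
by rewrite emul_bar.
Qed.

Lemma crossing_org p e (y : unitv (org e)) : tau (phi y) = src p ->
  org (crossing p y) = mk_vert (org e) (mul p (symb y)).
Proof.
move=> Ey; rewrite [LHS]bs_orgE /eorg; case: (e \in P) => //.
by rewrite (emulE Ey).
Qed.

Lemma crossing_bar p e (y : unitv (org e)) : tau (phi y) = src p ->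
  crossing (mul p (symb y)) (hunit (flip D e) (phi y)) = bar (crossing p y).
Proof.
move=> Ey; rewrite [RHS]bs_barE // /crossing in_orientation_bar symbK //.
by case: (e \in P).
Qed.

(** For e outside of the orientation the edge is obtained as the reverse of a
    crossing over bar e. *)
Lemma edge_crossing (c : edge forest) : exists p e (y : unitv (org e)),
  tau (phi y) = src p /\ c = crossing p y.
Proof.
have [e [p ->]] := bs_edgeP c.
have [ePt|ePf] := boolP (e \in P).
  by have [y [Ey _]] := emulP p e; exists p, e, y; rewrite /crossing ePt.
have [z [Ez Eq]] := emulP p (bar e).
exists (mul p (symb z)), (bar (bar e)), (hunit (flip D (bar e)) (phi z)); split.
  by rewrite tau_phi_bar src_mul ?rng_symb.
by rewrite crossing_bar // [RHS]bs_barE // in_orientation_bar (negPf ePf) barK.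
Qed.

(** The homomorphism [alpha_org D e] is [alpha D (bar e)] up to the equality
    tgt (bar e) = org e, which the fundamental groupoid does not see. *)
Lemma vincl_alpha_org e (g : arr (Ge D e)) : exists h : arr (Ge D (bar e)),
  vincl (alpha_org D e g) = vincl (alpha D (bar e) h) /\
  tau (rng (alpha_org D e g)) = tau (rng (alpha D (bar e) h)).
Proof.
exists (@ebar G D e g); rewrite /alpha_org /=.
move: (alpha D (bar e) _); move: (tgt_bar e).
by move: (tgt (bar e)) (org e) => a b E h; subst b.
Qed.

(** Both symbols of (R2) cross the same edge, because edges are cosets of H_|e|:
    p and p alpha_e(g) lie in the same coset of H_e, and by (R2) itself their
    products with the symbols of e lie in the same coset of H_(bar e). *)
Lemma crossing_slide p e (g : arr (Ge D e)) : src p = tau (rng (alpha D e g)) ->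
  crossing (mul p (vincl (alpha D e g))) (hunit (alpha_org D e) (src g))
  = crossing p (hunit (alpha_org D e) (rng g)).
Proof.
move=> pg; apply: mk_edge_eq => //; rewrite /ecoset /eabs.
case: (boolP (e \in P)) => eP.
  apply: (coset_eq (wideD _)); exists (alpha D e g); split=> //.
  by exists g.
rewrite -mul_assoc; first last.
- by rewrite src_vincl rng_symb phiE hom_src.
- by rewrite rng_vincl.
rewrite symb_R2 mul_assoc; first last.
- by rewrite src_symb rng_vincl hom_rng.
- by rewrite rng_symb phiE -hom_rng.
have [h [-> Eh]] := vincl_alpha_org g.
apply: (coset_eq (wideD _)); exists (alpha D (bar e) h); split=> //.
  by exists h.
by rewrite src_mul ?rng_symb ?phiE -?hom_rng // src_symb -hom_rng Eh.
Qed.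

(** * Potentials on the Bass-Serre forest *)

Section Potential.
Variable c : edge forest -> bool.
Hypothesis c_bar : forall d : edge forest, c (bar d) = c d.

(** Since e |-> p H_|e|[e] commutes with bar, it pulls c back to a labelling of
    the tree T. *)
Lemma translated_tree_potential p : exists gam : vert G -> bool,
  forall e : edge G, sedge T e -> gam (org e) (+) gam (tgt e) = c (mk_edge e p).
Proof.
have [tT ET] := maxT.
have inT v : svert T v by rewrite ET.
have [|F HF] := tree_potential
  (c := fun d : edge (graph_of_subgraph T) => c (mk_edge (sval d) p)) tT.
  by move=> d; rewrite -[RHS]c_bar; apply: (congr1 c (esym (bs_barE orP _ _))).
exists (fun v => F (exist _ v (inT v))) => e eT.
by rewrite -(HF (exist _ e eT)); congr (F _ (+) F _); apply: eq_exist.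
Qed.

Variable gam : arr Pi -> vert G -> bool.
Hypothesis gamP : forall p e,
  sedge T e -> gam p (org e) (+) gam p (tgt e) = c (mk_edge e p).

(** The sum of c along a path from p G_root to (p a) G_root, up to the values
    gam p root and gam (p a) root: the part of the path inside the translate of
    T by p, from p G_root to p G_v, has sum gam p root (+) gam p v. *)
Definition gen_label p (a : pi1_gen D) : bool :=
  match a with
  | GArr v g => gam p v (+) gam (mul p (vincl g)) v
  | GSym e y =>
      gam p (tgt e) (+) (c (crossing p y) (+) gam (mul p (symb y)) (org e))
  end.

Lemma gen_label_rel p (u1 u2 : word (pi1_gen D)) z : pi1_rel wideD T u1 u2 ->
  wpath (gen_rng wideD maxT root) (gen_src wideD maxT root) (src p) u1 z ->
  wpath (gen_rng wideD maxT root) (gen_src wideD maxT root) (src p) u2 z ->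
  walk_sum gen_label p u1 = walk_sum gen_label p u2.
Proof.
case=> {u1 u2} [v g h gh|v y|e x|e x eT|e g] [/esym pu _] _.
(* each [change] computes both sums letter by letter *)
- change (gen_label p (GArr g) (+)
    (gen_label (mul p (vincl g)) (GArr h) (+) false)
    = gen_label p (GArr (mul g h)) (+) false).
  rewrite /gen_label -mul_assoc ?rng_vincl ?src_vincl ?gh // vincl_mul //.
  by rewrite !addbF addbA addbK.
- change (gen_label p (GArr (idn y)) (+) false = false).
  have py : src p = tau y by rewrite pu /lrg /= rng_idn.
  by rewrite /gen_label vincl_idn -py mul_idn addbb.
- change (gen_label (mul p (inv (symb x))) (GSym x) (+) false
    = gen_label p (@GSym _ _ (bar e) (hunit (flip D e) (phi x))) (+) false).
  have px : src p = src (symb x) by [].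
  rewrite /gen_label !addbF mulgVK // -symb_inv.
  set q := mul p (inv (symb x)).
  have qx : tau (phi x) = src q by rewrite /q src_mul ?rng_inv ?src_inv.
  have Ep : p = mul q (symb x) by rewrite /q mulgVK.
  rewrite {3}Ep crossing_bar // c_bar tgt_bar org_bar.
  by case: (gam p _); case: (gam q _); case: (c _).
- change (gen_label p (GSym x) (+) false = false).
  have px : src p = tau x.
    by rewrite pu; apply: (congr1 (@rng Pi) (symb_R1 wideD maxT root x eT)).
  rewrite /gen_label /crossing symb_R1 // -px mul_idn.
  rewrite (_ : (if _ then _ else _) = p) -?(gamP p eT); last by case: (_ \in _).
  by case: (gam p _); case: (gam p _).
- change (gen_label p (GSym (hunit (alpha_org D e) (rng g))) (+)
    (gen_label (mul p (symb (hunit (alpha_org D e) (rng g))))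
       (GArr (alpha_org D e g)) (+)
    (gen_label (mul (mul p (symb (hunit (alpha_org D e) (rng g))))
                    (vincl (alpha_org D e g)))
       (@GSym _ _ (bar e) (hunit (flip D e) (hunit (alpha D e) (src g))))
     (+) false))
    = gen_label p (GArr (alpha D e g)) (+) false).
  have pg : src p = tau (rng (alpha D e g)) by rewrite pu /lrg /= phiE hom_rng.
  set s := symb _; set q := mul p (vincl (alpha D e g)).
  have ps : src p = rng s by rewrite /s rng_symb phiE -hom_rng.
  have qE : mul (mul p s) (vincl (alpha_org D e g))
      = mul q (symb (hunit (alpha_org D e) (src g))).
    rewrite /q -!mul_assoc ?symb_R2 //.
    + by rewrite src_vincl rng_symb phiE hom_src.
    + by rewrite /s src_symb rng_vincl hom_rng.
  have Eq : tau (phi (hunit (alpha_org D e) (src g))) = src q.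
    by rewrite /q src_mul // src_vincl phiE hom_src.
  rewrite /gen_label qE -(phiE wideD) symbK // crossing_bar // c_bar.
  rewrite crossing_slide // -/s tgt_bar org_bar -/q.
  by case: (c _); do 4 case: (gam _ _).
Qed.

End Potential.

(** The function f on the groupoid only accounts for the vertices p G_root; the
    term gam p v accounts for the passage from p G_root to p G_v, and makes
    f p (+) gam p v constant on the coset p G_v. *)
Lemma forest_potential (c : edge forest -> bool) :
  (forall d : edge forest, c (bar d) = c d) -> exists F, potential c F.
Proof.
move=> c_bar; have [gam gamP] := choice (translated_tree_potential c_bar).
have [f Hf] := cayley_potential (gen_label_rel c_bar gamP).
have f_vincl p v (g : arr (Gv D v)) : src p = tau (rng g) ->
    f (mul p (vincl g)) (+) gam (mul p (vincl g)) v = f p (+) gam p v.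
  by move=> pg; rewrite (Hf p (GArr g)) // /gen_label addbA addbK.
exists (fun a => f (vrep a) (+) gam (vrep a) (sval a).1) => d.
have FE v p :
    f (vrep (mk_vert v p)) (+) gam (vrep (mk_vert v p)) v = f p (+) gam p v.
  have /(coset_sameP (wide_setT D v)) [g [_ pg ->]] := esym (vrepE v p).
  exact: f_vincl.
have [p [e [y [Ey ->]]]] := edge_crossing d.
rewrite crossing_org // crossing_tgt // !FE (Hf p (GSym y)) // /gen_label.
by case: (c _); case: (f _); do 2 case: (gam _ _).
Qed.

(** * The components are connected and acyclic *)

Lemma linked_tree p v w : linked (mk_vert v p : vert forest) (mk_vert w p).
Proof.
have [s] := tree_path maxT v w.
elim: s v => [|e s IH] v /=; first by move=> -> _; apply: linked_refl.
case=> <- H /andP [/asboolP eT sT].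
have [y [Ey _]] := emulP p e.
have R1 := symb_R1 wideD maxT root y eT.
have Ep : src p = tau y by rewrite -Ey; apply: (congr1 (@rng Pi) R1).
have := linked_edge (crossing p y).
rewrite crossing_tgt // crossing_org // R1 -Ep mul_idn => L.
exact: linked_trans L (IH _ H sT).
Qed.

(** For a generator g in G_v the vertex p G_v = p g G_v lies on the translates
    of T by p and by p g; for a symbol a over e, the translates by p and by p a
    are joined by a crossing of e. *)
Lemma linked_gen p (a : pi1_gen D) : src p = gen_rng wideD maxT root a ->
  linked (mk_vert root p : vert forest)
    (mk_vert root (mul p (pgen _ _ (pi1_rel wideD T) a))).
Proof.
case: a => [v g|e y] pa.
  apply: linked_trans (linked_tree p root v) _.
  rewrite (@mk_vert_eq _ _ _ _ _ _ v v p (mul p (vincl g))) //.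
    exact: linked_tree.
  by apply/esym/(coset_eq (wide_setT D v)); exists g.
apply: linked_trans (linked_tree p root (tgt e)) _.
apply: linked_trans (linked_tree _ (org e) root).
by rewrite -(crossing_tgt (esym pa)) -(crossing_org (esym pa)); apply: linked_edge.
Qed.

Lemma linked_walk p (w : word (pi1_gen D)) z :
  wpath (gen_rng wideD maxT root) (gen_src wideD maxT root) (src p) w z ->
  linked (mk_vert root p : vert forest)
    (mk_vert root (walk (rel := pi1_rel wideD T) p w)).
Proof.
elim: w p => [|l w IH] p; first by move=> _; apply: linked_refl.
case=> pl H.
have {}pl : src p = rng (gen_arr l) by rewrite rng_letter.
apply: (@linked_trans forest _ (mk_vert root (mul p (gen_arr l)))); last first.
  by apply: IH; rewrite src_mul // src_letter.
case: l {H} pl => a [] pl; last exact: linked_gen.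
apply: linked_sym; rewrite -{2}(@mulgVK Pi p (pgen _ _ _ a)) //.
by apply: linked_gen; rewrite src_mul ?rng_inv ?src_inv.
Qed.

Lemma linked_base p :
  linked (mk_vert root (idn (rng p)) : vert forest) (mk_vert root p).
Proof.
have [w Hw pw] := pcls_inhabited p.
by have := @linked_walk (idn (rng p)) w (src p) pw; rewrite walk_idn.
Qed.

Lemma component_connected (x : gunit Pi) :
  connected (graph_of_subgraph (bs_component orP x)).
Proof.
apply: (@connected_subgraph forest _ (mk_vert root (idn x : arr Pi))).
- by rewrite /= /preimage /= bs_rngE.
- move=> d dx; have : bs_rng (org (bar d)) = x by rewrite org_bar.
  by move/(bs_rng_bar orP); rewrite -[bs_bar _]/(bar (bar d)) barK.
- move=> a; have [v [p ->]] := bs_vertP a; rewrite /= /preimage /= bs_rngE => <-.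
  exact: linked_trans (linked_base p) (linked_tree _ _ _).
Qed.

Lemma component_acyclic (x : gunit Pi)
  (v : vert (graph_of_subgraph (bs_component orP x))) s :
  gpath v s v -> no_backtracking s -> s = [::].
Proof.
by apply: acyclic_subgraph; apply: acyclic_of_potentials; apply: forest_potential.
Qed.

End Forest.

Theorem proposition6p18 (G : graph) (D : graph_of_groupoids G)
    (connG : connected G)
    (wideD : forall e : edge G, wide_subgroupoid (Hsub D e))
    (T : subgraph G) (maxT : maximal_subtree T)
    (root : vert G) (rootT : svert T root)
    (P : set (edge G)) (orP : orientation P)
    (x : gunit (pi1 wideD maxT root)) :
  tree (graph_of_subgraph (bs_component orP x)).
Proof.
split; first exact: component_connected.
exact: component_acyclic.
Qed.
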